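(* Let $k\ge1$, $n\ge1$, let $(p_n,\dots,p_1)$ be a level $k$ restricted path of length $n$, and let $(\epsilon_n,\dots,\epsilon_1)\in\{0,1\}^n$. Then, as formal series in $z_1^{\pm1},\dots,z_n^{\pm1}$, $$\varphi^{\ast p_n}_{\epsilon_n}(z_n)\cdots\varphi^{\ast p_1}_{\epsilon_1}(z_1)[[\ ]]=\sum_{(m_1,\dots,m_n)\in M}C(m_n\cdots m_1)\,[[2m_n+\epsilon_n-p_n,\dots,2m_1+\epsilon_1-p_1]],$$ where $$C(m_n\cdots m_1)=\prod_{r=1}^nz_r^{\nu_r}\ \det\big(z_i^{m_j-\nu_j}\big)_{1\le i,j\le n},\qquad \nu_j=-\sum_{r=j}^{n-1}\big(-K(p_{r+1},p_r)+H(\epsilon_r,\epsilon_{r+1})\big),$$ and $$M=\{(m_1,\dots,m_n)\in\mathbb Z^n\ |\ 2m_n+\epsilon_n-2I_n\ge\cdots\ge2m_2+\epsilon_2-2I_2\ge2m_1+\epsilon_1\},\qquad I_r=\sum_{s=1}^{r-1}H(p_{s+1},p_s).$$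
   Context: **Creation algebra.** $H(0,0)=H(0,1)=H(1,1)=0$, $H(1,0)=1$, $K=1-H$; $\epsilon(j)=0$ for $j$ even, $1$ for $j$ odd. $\mathcal A$ is the associative unital $\mathbb Z$-algebra with generators $\varphi^{\ast p}_j$ ($j\in\mathbb Z$, $p\in\{0,1\}$) and relations $$\varphi^{\ast p_2}_{j_2}\varphi^{\ast p_1}_{j_1}+\varphi^{\ast p_2}_{j_1-2K(p_2,p_1)+\epsilon(j_1+j_2)}\varphi^{\ast p_1}_{j_2+2K(p_2,p_1)-\epsilon(j_1+j_2)}=0,$$ where, if the two monomials coincide, the relation is read as: that monomial is $0$. A monomial $\varphi^{\ast p_n}_{j_n}\cdots\varphi^{\ast p_1}_{j_1}$ is normal if $j_{r+1}-j_r\ge2H(p_{r+1},p_r)$ for $1\le r\le n-1$. Every monomial is $0$ or equals $\mu$ times a unique normal monomial with the same upper indices, for a unique $\mu\in\{\pm1\}$. Generating series: for $\epsilon\in\{0,1\}$, $\varphi^{\ast p}_\epsilon(z)=\sum_{m\in\mathbb Z}\varphi^{\ast p}_{2m+\epsilon}z^m$. **Restricted paths.** A level $k$ restricted path of length $n$ is $(p_n,\dots,p_1)\in\{0,1\}^n$ with $(-1)^{p_1}+\cdots+(-1)^{p_s}\in\{0,\dots,k\}$ for $1\le s\le n$ (so $p_1=0$). **Paths $[[\cdots]]$.** For a restricted path $(p_n,\dots,p_1)$ and a normal sequence $(j_n,\dots,j_1)$ put $m'_s=(-1)^{p_1}+\cdots+(-1)^{p_s}$, $m'_0=0$, $l_r=j_r-p_r$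 (then $l_n\ge\cdots\ge l_1$). $[[j_n-p_n,\dots,j_1-p_1]]$ denotes the sequence $(p(i))_{i\in\mathbb Z}$ with $p(i)=m'_r+(k-2m'_r)\epsilon(i)$ for $l_r+1\le i\le l_{r+1}$ ($l_0=-\infty$, $l_{n+1}=+\infty$); $[[\ ]]$ is the sequence for $n=0$. Distinct data (restricted path, normal sequence) give distinct sequences; let $F$ be the free $\mathbb Z$-module on all these sequences. **Action of $\mathcal A$ on $F$.** For $b=[[j_{n-1}-p_{n-1},\dots,j_1-p_1]]$: $\varphi^{\ast p}_jb=0$ if $(p,p_{n-1},\dots,p_1)$ is not restricted or if $\varphi^{\ast p}_j\varphi^{\ast p_{n-1}}_{j_{n-1}}\cdots\varphi^{\ast p_1}_{j_1}=0$ in $\mathcal A$; otherwise, writing this product as $\mu\,\varphi^{\ast p}_{j'_n}\varphi^{\ast p_{n-1}}_{j'_{n-1}}\cdots\varphi^{\ast p_1}_{j'_1}$ with the latter normal and $\mu\in\{\pm1\}$, $\varphi^{\ast p}_jb=\mu[[j'_n-p,j'_{n-1}-p_{n-1},\dots,j'_1-p_1]]$. *)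

(* Defs.v *)
From HB Require Import structures.
From mathcomp Require Export all_boot all_order all_algebra.
From mathcomp Require Export boolp classical_sets cardinality fsbigop.
From mathcomp Require Export finmap monalg.
From mathcomp Require Import zify.

Set Implicit Arguments.
Unset Strict Implicit.
Unset Printing Implicit Defensive.

Import Order.TTheory GRing.Theory Num.Theory.
Local Open Scope ring_scope.

(* Convention: a sequence written (x_n, ..., x_1) in the mathematical text is
   stored as [:: x_1; ...; x_n], i.e. in the order in which the operators act
   on the vacuum; x_r sits at position r - 1.  Indices p in {0, 1} are booleans
   (1 is true). *)

Definition Hfun (p q : bool) : int := (p && ~~ q)%:Z.
Definition Kfun (p q : bool) : int := 1 - Hfun p q.
Definition parity (j : int) : int := (j %% 2)%Z.

(* (p, j) stands for the generator phi^{*p}_j. *)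
Definition letter : Type := (bool * int)%type.
HB.instance Definition _ := Choice.on letter.

Definition freeAlg : Type := {malg int[{fmonom letter}]}.
HB.instance Definition _ := GRing.NzRing.on freeAlg.

Definition gen (p : bool) (j : int) : freeAlg := << fmu (p, j) >>.

(* phi^{*p_n}_{j_n} ... phi^{*p_1}_{j_1}, for w = [:: (p_1, j_1); ...; (p_n, j_n)] *)
Definition monomial (w : seq letter) : freeAlg :=
  \prod_(x <- rev w) gen x.1 x.2.

Definition relator (p2 p1 : bool) (j2 j1 : int) : freeAlg :=
  let u := gen p2 j2 * gen p1 j1 in
  let v := gen p2 (j1 - 2 * Kfun p2 p1 + parity (j1 + j2))
         * gen p1 (j2 + 2 * Kfun p2 p1 - parity (j1 + j2)) in
  if u == v then u else u + v.

Inductive relIdeal : freeAlg -> Prop :=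
| relIdeal_relator p2 p1 j2 j1 : relIdeal (relator p2 p1 j2 j1)
| relIdeal0 : relIdeal 0
| relIdealB x y : relIdeal x -> relIdeal y -> relIdeal (x - y)
| relIdealMl a x : relIdeal x -> relIdeal (a * x)
| relIdealMr x a : relIdeal x -> relIdeal (x * a).

(* Equality in the creation algebra, the quotient of freeAlg by relIdeal. *)
Definition eqA (x y : freeAlg) : Prop := relIdeal (x - y).

Definition normal (w : seq letter) : bool :=
  sorted (fun x y : letter => 2 * Hfun y.1 x.1 <= y.2 - x.2) w.

Definition height (p : seq bool) : int := \sum_(q <- p) (-1) ^+ q.

Definition restricted (k : nat) (p : seq bool) : bool :=
  all (fun s => 0 <= height (take s p) <= k%:Z) (iota 1 (size p)).

Definition admissible (k : nat) (w : seq letter) : bool :=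
  restricted k (map fst w) && normal w.

(* The sequence [[j_n - p_n, ..., j_1 - p_1]].  Since l_1 <= ... <= l_n for a
   normal w, the r with l_r + 1 <= i <= l_{r+1} is the number of indices s with
   l_s < i; see bracketE. *)
Definition shifts (w : seq letter) : seq int := [seq x.2 - (nat_of_bool x.1)%:Z | x <- w].

Definition bracket (k : nat) (w : seq letter) (i : int) : int :=
  let m := height (take (count (fun l => l < i) (shifts w)) (map fst w)) in
  m + (k%:Z - 2 * m) * parity i.

Lemma shifts_sorted (w : seq letter) : normal w -> sorted <=%R (shifts w).
Proof.
rewrite /normal /shifts sorted_map; apply: sub_sorted => -[p i] [q j] /=.
by case: p; case: q; rewrite /Hfun /=; lia.
Qed.

Lemma bracketE (k : nat) (w : seq letter) (r : nat) (i : int) :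
    normal w -> (r <= size w)%N ->
    ((0 < r)%N -> nth 0 (shifts w) r.-1 + 1 <= i) ->
    ((r < size w)%N -> i <= nth 0 (shifts w) r) ->
  let m := height (take r (map fst w)) in
  bracket k w i = m + (k%:Z - 2 * m) * parity i.
Proof.
move=> /shifts_sorted sw rw lo hi /=.
have szw : size (shifts w) = size w by rewrite size_map.
suff rE : count (fun l => l < i) (shifts w) = r by rewrite /bracket rE.
rewrite -(cat_take_drop r (shifts w)) count_cat.
have mono a b : (a <= b < size w)%N ->
    nth 0 (shifts w) a <= nth 0 (shifts w) b.
  by case/andP=> ab bw; apply: sorted_leq_nth => //;
    [exact: le_trans|rewrite inE szw|rewrite inE szw]; lia.
have : all (fun l => l < i) (take r (shifts w)).
  apply/(all_nthP 0) => s; rewrite size_takel ?szw // => sr.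
  rewrite nth_take //; have := mono s r.-1; have := lo; lia.
rewrite all_count => /eqP ->.
have : ~~ has (fun l => l < i) (drop r (shifts w)).
  apply/(has_nthP 0) => -[s]; rewrite size_drop szw nth_drop => sr.
  by have := mono r (r + s)%N; have := hi; lia.
rewrite has_count lt0n negbK => /eqP ->.
by rewrite size_takel ?szw // addn0.
Qed.

Record pathSeq (k : nat) : Type := PathSeq {
  pathSeq_fun : int -> int;
  _ : `[< exists2 w, admissible k w & pathSeq_fun = bracket k w >] }.
HB.instance Definition _ k := [isSub for @pathSeq_fun k].
HB.instance Definition _ k := [Choice of pathSeq k by <:].

Definition Fock (k : nat) : Type := {malg int[pathSeq k]}.
HB.instance Definition _ k := GRing.Lmodule.on (Fock k).

(* The basis vector [[j_n - p_n, ..., j_1 - p_1]]; the value 0 is a default,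
   never used on an admissible w. *)
Definition ket (k : nat) (w : seq letter) : Fock k :=
  if insub (bracket k w) is Some b then << b >> else 0.
Arguments ket : clear implicits.

Definition vacuum (k : nat) : Fock k := ket k [::].

(* actSpec p j b v: phi^{*p}_j b = v, the sign (-1) ^+ mu being the mathematical
   mu in {1, -1}. *)
Variant actSpec (k : nat) (p : bool) (j : int) : pathSeq k -> Fock k -> Prop :=
| ActNotRestricted (b : pathSeq k) w :
    admissible k w -> val b = bracket k w ->
    ~~ restricted k (map fst (rcons w (p, j))) ->
    actSpec p j b 0
| ActNull (b : pathSeq k) w :
    admissible k w -> val b = bracket k w ->
    eqA (monomial (rcons w (p, j))) 0 ->
    actSpec p j b 0
| ActNormal (b : pathSeq k) w (mu : bool) w' :
    admissible k w -> val b = bracket k w ->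
    restricted k (map fst (rcons w (p, j))) ->
    ~ eqA (monomial (rcons w (p, j))) 0 ->
    map fst w' = map fst (rcons w (p, j)) -> normal w' ->
    eqA (monomial (rcons w (p, j))) ((-1) ^+ mu * monomial w') ->
    actSpec p j b ((-1) ^+ mu *: ket k w').

(* actSpec p j b holds of exactly one vector, since normal forms in the algebra
   are unique and bracket k is injective on admissible words; xget's default 0
   is not used. *)
Definition actBasis (k : nat) (p : bool) (j : int) (b : pathSeq k) : Fock k :=
  xget 0 [set v | actSpec p j b v]%classic.

Definition phi (k : nat) (p : bool) (j : int) (v : Fock k) : Fock k :=
  \sum_(b <- msupp v) v@_b *: actBasis p j b.

(* Coefficient of z^m in phi^{*p}_e(z). *)
Definition phiSeries (k : nat) (p e : bool) (m : int) : Fock k -> Fock k :=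
  phi p (2 * m + e%:Z).

Definition expo (n : nat) : Type := {ffun 'I_n -> int}.
HB.instance Definition _ n := GRing.Zmodule.on (expo n).

(* Formal series in z_1^{+-1}, ..., z_n^{+-1}, given by their coefficients;
   z_r is indexed by the ordinal r - 1. *)
Definition fseries (n : nat) (V : Type) : Type := expo n -> V.

(* phi^{*p_n}_{e_n}(z_n) ... phi^{*p_1}_{e_1}(z_1) [[ ]] *)
Definition phiProduct (k n : nat) (p e : n.-tuple bool) : fseries n (Fock k) :=
  fun a => foldl (fun v i => phiSeries (tnth p i) (tnth e i) (a i) v)
                 (vacuum k) (enum 'I_n).
Arguments phiProduct : clear implicits.

(* S is the sum over m in D of the formal series f m: for each monomial z^a only
   finitely many terms contribute, and the coefficients agree. *)
Definition is_fsum (I : choiceType) (n : nat) (V : zmodType) (D : set I)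
    (f : I -> fseries n V) (S : fseries n V) : Prop :=
  forall a : expo n,
    finite_set (D `&` [set m | f m a != 0])%classic
    /\ S a = \sum_(m \in D) f m a.

(* The group ring Z[G]; Laurent polynomials are Z[Z^n].  (The ring structure of
   {malg R[K]} in the library requires a K without nontrivial units.) *)
Section GroupRing.
Variable G : zmodType.

Definition groupRing : Type := {malg int[G]}.
HB.instance Definition _ := GRing.Zmodule.on groupRing.
Implicit Types x y : groupRing.

Definition grone : groupRing := << 0 >>.
Definition grmul x y : groupRing :=
  \sum_(u <- msupp x) \sum_(v <- msupp y) << x@_u * y@_v *g u + v >>.

Lemma grmulw (d1 d2 : {fset G}) x y :
    (msupp x `<=` d1)%fset -> (msupp y `<=` d2)%fset ->
  grmul x y = \sum_(u <- d1) \sum_(v <- d2) << x@_u * y@_v *g u + v >>.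
Proof.
move=> le1 le2; rewrite /grmul (big_fset_incl _ le1) /=.
  apply/eq_bigr=> u _; apply/big_fset_incl => // v _ /mcoeff_outdom ->.
  by rewrite mulr0 monalgU0.
move=> u _ /mcoeff_outdom xu.
by rewrite big1 => // v _; rewrite xu mul0r monalgU0.
Qed.

Lemma grmulC : commutative grmul.
Proof.
move=> x y; rewrite /grmul exchange_big /=; apply: eq_bigr => v _.
by apply: eq_bigr => u _; rewrite mulrC addrC.
Qed.

Lemma grmulDl : left_distributive grmul +%R.
Proof.
move=> x y t.
rewrite [in RHS](grmulw (fsubsetUl _ (msupp y)) (fsubset_refl _)).
rewrite [in RHS](grmulw (fsubsetUr (msupp x) _) (fsubset_refl _)).
rewrite (grmulw (msuppD_le _ _) (fsubset_refl _)).
rewrite -big_split /=; apply/eq_bigr=> u _.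
rewrite -big_split /=; apply/eq_bigr=> v _.
by rewrite mcoeffD mulrDl monalgUD.
Qed.

Lemma grmulDr : right_distributive grmul +%R.
Proof. by move=> t x y; rewrite grmulC grmulDl !(grmulC t). Qed.

Lemma grmulUU (c d : int) (u v : G) :
  grmul << c *g u >> << d *g v >> = << c * d *g u + v >>.
Proof. by rewrite (grmulw msuppU_le msuppU_le) !big_seq_fset1 !mcoeffUU. Qed.

Lemma grmul0r : left_zero 0 grmul.
Proof. by move=> x; rewrite /grmul msupp0 big_seq_fset0. Qed.

Lemma grmulr0 : right_zero 0 grmul.
Proof. by move=> x; rewrite grmulC grmul0r. Qed.

Lemma grmul1r : left_id grone grmul.
Proof.
move=> x; rewrite (grmulw msuppU_le (fsubset_refl _)) big_seq_fset1.
rewrite [RHS]monalgE; apply: eq_bigr => v _.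
by rewrite mcoeffUU mul1r add0r.
Qed.

Lemma grmul_sumr (I : Type) (s : seq I) (f : I -> groupRing) y :
  grmul (\sum_(i <- s) f i) y = \sum_(i <- s) grmul (f i) y.
Proof.
exact: (big_morph (grmul^~ y) (fun a b => grmulDl a b y) (grmul0r y)).
Qed.

Lemma grmulr_sum (I : Type) (s : seq I) (f : I -> groupRing) x :
  grmul x (\sum_(i <- s) f i) = \sum_(i <- s) grmul x (f i).
Proof. exact: (big_morph (grmul x) (grmulDr x) (grmulr0 x)). Qed.

Lemma grmulA : associative grmul.
Proof.
have UUU (u v z : int * G) : grmul << u.1 *g u.2 >> (grmul << v.1 *g v.2 >>
    << z.1 *g z.2 >>) = grmul (grmul << u.1 *g u.2 >> << v.1 *g v.2 >>)
    << z.1 *g z.2 >>.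
  by rewrite !grmulUU mulrA addrA.
have UU (u v : int * G) t : grmul << u.1 *g u.2 >> (grmul << v.1 *g v.2 >> t)
    = grmul (grmul << u.1 *g u.2 >> << v.1 *g v.2 >>) t.
  rewrite [t]monalgE [grmul << v.1 *g v.2 >> _]grmulr_sum.
  rewrite [LHS]grmulr_sum [RHS]grmulr_sum; apply: eq_bigr => z _.
  exact: (UUU u v (_, z)).
have U (u : int * G) y t : grmul << u.1 *g u.2 >> (grmul y t)
    = grmul (grmul << u.1 *g u.2 >> y) t.
  rewrite [y]monalgE [grmul (\sum_(_ <- _) _) t]grmul_sumr.
  rewrite [LHS]grmulr_sum [grmul _ (\sum_(_ <- _) _)]grmulr_sum.
  rewrite [RHS]grmul_sumr; apply: eq_bigr => v _.
  exact: (UU u (_, v)).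
move=> x y t; rewrite [x]monalgE [LHS]grmul_sumr.
rewrite [grmul (\sum_(_ <- _) _) y]grmul_sumr [RHS]grmul_sumr.
by apply: eq_bigr => u _; exact: (U (_, u)).
Qed.

Lemma grone_neq0 : grone != 0.
Proof. by apply/eqP/malgP=> /(_ 0) /eqP; rewrite mcoeffUU mcoeff0. Qed.

HB.instance Definition _ := GRing.Zmodule_isComNzRing.Build groupRing
  grmulA grmulC grmul1r grmulDl grone_neq0.
End GroupRing.

Definition laurent (n : nat) : Type := groupRing (expo n).
HB.instance Definition _ n := GRing.ComNzRing.on (laurent n).

(* z_i ^ d *)
Definition zpow (n : nat) (i : 'I_n) (d : int) : laurent n :=
  << [ffun i' => if i' == i then d else 0] : expo n >>.

Section Coefficients.
Variables (n : nat) (p e : n.-tuple bool).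

(* Sums over 1-based indices r are shifted to the 0-based r - 1. *)
Definition nu (j : 'I_n) : int :=
  - \sum_(j <= r < n.-1)
      (- Kfun (nth false p r.+1) (nth false p r)
       + Hfun (nth false e r) (nth false e r.+1)).

Definition Isum (r : 'I_n) : int :=
  \sum_(0 <= s < r) Hfun (nth false p s.+1) (nth false p s).

Definition Mset : set (expo n) :=
  [set m | forall r s : 'I_n, s = r.+1 :> nat ->
     2 * m r + (tnth e r)%:Z - 2 * Isum r
     <= 2 * m s + (tnth e s)%:Z - 2 * Isum s]%classic.

Definition Ccoef (m : expo n) : laurent n :=
  (\prod_(r < n) zpow r (nu r)) * \det (\matrix_(i, j) zpow i (m j - nu j)).

(* [:: (p_1, 2 m_1 + e_1); ...; (p_n, 2 m_n + e_n)] *)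
Definition wordOf (m : expo n) : seq letter :=
  [seq (tnth p i, 2 * m i + (tnth e i)%:Z) | i <- enum 'I_n].

End Coefficients.

(* Main.v *)
Require Import Defs.
From mathcomp Require Import perm zify ring.

(* After fixing the upper indices p and the parities e, which the relations
   preserve, and shifting m_j to m_j - nu_j, the defining relations say that a
   monomial changes sign when two adjacent entries are exchanged, and a monomial
   is normal iff its entries strictly increase: each (p, e)-component of the
   creation algebra is an exterior power.  Insertion sort gives normal forms; for
   a fixed strictly increasing sequence, the determinant of coincidences between
   it and the entries of a monomial is a functional vanishing on the relations,
   which gives their uniqueness.  The same determinant is the coefficient of z^a
   in C(m_n ... m_1), so applying the functional to the monomial of a produced
   by the iterated action gives the formula. *)

Set Implicit Arguments.
Unset Strict Implicit.
Unset Printing Implicit Defensive.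

Import Order.TTheory GRing.Theory Num.Theory.
Local Open Scope ring_scope.

(** * Congruence modulo the ideal of relations *)

Lemma eqA_refl x : eqA x x.
Proof. by rewrite /eqA subrr; exact: relIdeal0. Qed.

Lemma relIdealN x : relIdeal x -> relIdeal (- x).
Proof. by move=> xI; rewrite -sub0r; apply: relIdealB => //; exact: relIdeal0. Qed.

Lemma relIdealD x y : relIdeal x -> relIdeal y -> relIdeal (x + y).
Proof. by move=> xI /relIdealN yI; rewrite -[y]opprK; exact: relIdealB. Qed.

Lemma eqA_sym x y : eqA x y -> eqA y x.
Proof. by move=> /relIdealN; rewrite opprB. Qed.

Lemma eqA_trans y x z : eqA x y -> eqA y z -> eqA x z.
Proof. by move=> xy /(relIdealD xy); rewrite addrA subrK. Qed.

Lemma eqAN x y : eqA x y -> eqA (- x) (- y).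
Proof. by move=> /relIdealN; rewrite /eqA opprD. Qed.

Lemma eqAMl a x y : eqA x y -> eqA (a * x) (a * y).
Proof. by move=> /(relIdealMl a); rewrite mulrBr. Qed.

Lemma eqAMl0 a x : eqA x 0 -> eqA (a * x) 0.
Proof. by move=> /(eqAMl a); rewrite mulr0. Qed.

Lemma monomial_rcons w x : monomial (rcons w x) = gen x.1 x.2 * monomial w.
Proof. by rewrite /monomial rev_rcons big_cons. Qed.

Lemma monomial_cat w1 w2 : monomial (w1 ++ w2) = monomial w2 * monomial w1.
Proof. by rewrite /monomial rev_cat big_cat. Qed.

(** Words list operators in order of action, free monomials list factors from left to right, hence
    the [rev]. Monomials are thus basis elements, on which a functional can be prescribed freely. *)
Lemma monomialE w : monomial w = << FMonom (rev w) >>.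
Proof.
elim/last_ind: w => [|w x IH].
  rewrite /monomial big_nil /= -[FMonom _]fmoneE.
 by [].
rewrite monomial_rcons IH rev_rcons malgM_def fgmulUU mulr1 fmuE.
congr (<< _ *g _ >>).
by case: x => q j; exact: fmmulE.
Qed.

(** * Normal forms *)

Section Words.
Variables (p e : nat -> bool).
Implicit Types (kap : seq int) (r : nat).

(* The relations exchange m_{r+1} and m_r up to a shift by [swap_shift r];
   absorbing the accumulated shifts into kap_r = m_r + [total_shift r] turns
   them into the antisymmetry of plain transpositions. *)
Definition swap_shift r : int := Kfun (p r.+1) (p r) - Hfun (e r) (e r.+1).
Definition total_shift r : int := \sum_(0 <= s < r) swap_shift s.
Definition mkletter r (x : int) : letter :=
  (p r, 2 * (x - total_shift r) + (e r)%:Z).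
Definition mkword kap : seq letter :=
  mkseq (fun r => mkletter r (nth 0 kap r)) (size kap).
Definition keys (w : seq letter) : seq int :=
  mkseq (fun r => ((nth (false, 0%:Z) w r).2 %/ 2)%Z + total_shift r) (size w).

Lemma total_shiftS r : total_shift r.+1 = total_shift r + swap_shift r.
Proof. by rewrite /total_shift big_nat_recr. Qed.

Lemma size_mkword kap : size (mkword kap) = size kap.
Proof. by rewrite size_mkseq. Qed.

Lemma mkword_rcons kap x :
  mkword (rcons kap x) = rcons (mkword kap) (mkletter (size kap) x).
Proof.
rewrite /mkword /mkseq size_rcons -addn1 iotaD map_cat /= cats1 add0n.
rewrite nth_rcons ltnn eqxx; congr rcons; apply/eq_in_map => r.
by rewrite mem_iota add0n nth_rcons => /andP[_ ->].
Qed.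

Lemma mkwordK kap : keys (mkword kap) = kap.
Proof.
apply: (@eq_from_nth _ 0); rewrite size_mkseq size_mkword // => r rk.
rewrite nth_mkseq ?size_mkword // nth_mkseq // /mkletter /=.
by case: (e r); lia.
Qed.

Lemma map_fst_mkword kap : map fst (mkword kap) = mkseq p (size kap).
Proof. by rewrite /mkword /mkseq -map_comp. Qed.

Lemma normal_rcons2 w x y :
  normal (rcons (rcons w x) y) =
  normal (rcons w x) && (2 * Hfun y.1 x.1 <= y.2 - x.2).
Proof.
rewrite /normal; case: w => [|z w] /=; first by rewrite andbT.
by rewrite rcons_path last_rcons.
Qed.

(** The contributions of [p] cancel: what remains is 2(y - x) >= 2 for equal parities and 2(y - x)
    >= 1 for different ones. *)
Lemma normal_letter r (x y : int) :
  (2 * Hfun (p r.+1) (p r) <= (mkletter r.+1 y).2 - (mkletter r x).2) = (x < y).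
Proof.
rewrite /mkletter total_shiftS /= /swap_shift /Kfun /Hfun.
by move: (p r) (p r.+1) (e r) (e r.+1) => [] [] [] [] /=; lia.
Qed.

Lemma sorted_rcons2 (kap : seq int) x y :
  sorted <%R (rcons (rcons kap x) y) = sorted <%R (rcons kap x) && (x < y).
Proof.
case: kap => [|z kap] /=; first by rewrite andbT.
by rewrite rcons_path last_rcons.
Qed.

Lemma normal_mkword kap : normal (mkword kap) = sorted <%R kap.
Proof.
elim/last_ind: kap => [|kap y IH] //.
elim/last_ind: kap IH => [|kap x _] IH //.
rewrite sorted_rcons2 -IH !mkword_rcons normal_rcons2 size_rcons.
by rewrite normal_letter.
Qed.

Lemma parity_mkletter r (x y : int) :
  parity ((mkletter r x).2 + (mkletter r.+1 y).2) = (e r (+) e r.+1)%:Z.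
Proof.
rewrite /parity /mkletter /=.
by move: (e r) (e r.+1) => [] [] /=; lia.
Qed.

(** The term 2K is absorbed by the step of [total_shift], and the parity term turns [e r] into
    [e r.+1] up to the 2H in that step, so the key x moves up unchanged. *)
Lemma swap_upper r (x y : int) :
  (p r.+1, (mkletter r x).2 - 2 * Kfun (p r.+1) (p r)
     + parity ((mkletter r x).2 + (mkletter r.+1 y).2)) = mkletter r.+1 x.
Proof.
rewrite parity_mkletter; congr (_, _).
rewrite /mkletter total_shiftS /= /swap_shift /Kfun /Hfun.
by move: (p r) (p r.+1) (e r) (e r.+1) => [] [] [] [] /=; lia.
Qed.

Lemma swap_lower r (x y : int) :
  (p r, (mkletter r.+1 y).2 + 2 * Kfun (p r.+1) (p r)
     - parity ((mkletter r x).2 + (mkletter r.+1 y).2)) = mkletter r y.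
Proof.
rewrite parity_mkletter; congr (_, _).
rewrite /mkletter total_shiftS /= /swap_shift /Kfun /Hfun.
by move: (p r) (p r.+1) (e r) (e r.+1) => [] [] [] [] /=; lia.
Qed.

Lemma relIdeal_pair r (x y : int) :
  let u := gen (p r.+1) (mkletter r.+1 y).2 * gen (p r) (mkletter r x).2 in
  let v := gen (p r.+1) (mkletter r.+1 x).2 * gen (p r) (mkletter r y).2 in
  relIdeal (if u == v then u else u + v).
Proof.
have := relIdeal_relator (p r.+1) (p r) (mkletter r.+1 y).2 (mkletter r x).2.
rewrite /relator.
by have [->] := swap_upper r x y; have [->] := swap_lower r x y.
Qed.

Lemma monomial_swap kap x y :
  eqA (monomial (mkword (rcons (rcons kap x) y)))
      (- monomial (mkword (rcons (rcons kap y) x))).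
Proof.
rewrite !mkword_rcons !monomial_rcons !size_rcons /= !mulrA.
have := @relIdeal_pair (size kap) x y; rewrite /=.
(* If the two monomials coincide, the relator is u itself, and u + u is still in the ideal. *)
set u := _ * _; set v := _ * _; case: eqP => [<- uI|_ uvI].
  by rewrite /eqA opprK -mulrDl; apply: relIdealMr; exact: relIdealD.
by rewrite /eqA opprK -mulrDl; exact: relIdealMr.
Qed.

Lemma monomial_repeat kap x : eqA (monomial (mkword (rcons (rcons kap x) x))) 0.
Proof.
rewrite !mkword_rcons !monomial_rcons !size_rcons /= !mulrA /eqA subr0.
by have := @relIdeal_pair (size kap) x x; rewrite /= eqxx; exact: relIdealMr.
Qed.

(** The permutation clause lets a bound on all keys survive straightening, so that a larger key can
    be appended afterwards. *)
Definition straightens kap : Prop :=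
  eqA (monomial (mkword kap)) 0 \/
  exists (mu : bool) kap', [/\ perm_eq kap' kap, sorted <%R kap' &
    eqA (monomial (mkword kap)) ((-1) ^+ mu * monomial (mkword kap'))].

(** One insertion: if x is below the last key y, exchange them with a sign, insert x into the keys
    before y, and append y again; y exceeds all of these. *)
Lemma straightens_rcons kap x :
  sorted <%R kap -> straightens (rcons kap x).
Proof.
elim/last_ind: kap x => [|kap y IH] x skap.
  by right; exists false, [:: x]; split=> //; rewrite mul1r; exact: eqA_refl.
case: (ltgtP y x) => [yx|xy|->]; last by left; exact: monomial_repeat.
  right; exists false, (rcons (rcons kap y) x); split=> //.
    by rewrite sorted_rcons2 skap.
  by rewrite mul1r; exact: eqA_refl.
have sw := monomial_swap kap y x.
have /andP[ally skap0] : all (< y) kap && sorted <%R kap.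
  by move: skap; rewrite !(sorted_pairwise lt_trans) pairwise_rcons.
rewrite [mkword (rcons (rcons kap x) y)]mkword_rcons monomial_rcons in sw.
case: (IH x skap0) => [z|[mu [kap' [kk' skap' eqk']]]].
  left; apply: (eqA_trans sw);
  by rewrite -mulrN; apply: eqAMl0; rewrite -oppr0; exact: eqAN.
right; exists (~~ mu), (rcons kap' y); split.
- rewrite -!cats1 -catA; apply: (@perm_trans _ ((kap ++ [:: x]) ++ [:: y])).
    by rewrite perm_cat2r cats1.
  by rewrite -catA perm_cat2l (perm_catC [:: x]).
- rewrite (sorted_pairwise lt_trans) pairwise_rcons.
  rewrite -(sorted_pairwise lt_trans) skap' andbT (perm_all _ kk') all_rcons.
  by rewrite xy.
apply: (eqA_trans sw); rewrite [mkword (rcons kap' y)]mkword_rcons.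
rewrite monomial_rcons (perm_size kk').
rewrite -mulrN; apply: (@eqA_trans (gen (mkletter (size (rcons kap x)) y).1
   (mkletter (size (rcons kap x)) y).2 * ((-1) ^+ (~~ mu) * monomial (mkword kap')))).
  by apply: eqAMl; rewrite signrN mulNr; exact: eqAN.
by rewrite !mulr_sign; case: (~~ mu); rewrite ?mulrN; exact: eqA_refl.
Qed.

Lemma straightensP kap : straightens kap.
Proof.
elim/last_ind: kap => [|kap x [z|[mu [kap' [kk' skap' eqk']]]]].
- by right; exists false, [::]; split=> //; rewrite mul1r; exact: eqA_refl.
- by left; rewrite mkword_rcons monomial_rcons; exact: eqAMl0.
have eqx : eqA (monomial (mkword (rcons kap x)))
    ((-1) ^+ mu * monomial (mkword (rcons kap' x))).
  rewrite !mkword_rcons !monomial_rcons (perm_size kk').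
  have := eqAMl (gen (mkletter (size kap) x).1 (mkletter (size kap) x).2) eqk'.
  by rewrite !mulr_sign; case: mu {eqk'}; rewrite ?mulrN.
case: (straightens_rcons x skap') => [z|[mu' [kap2 [kk2 skap2 eqk2]]]].
  by left; apply: (eqA_trans eqx); exact: eqAMl0.
right; exists (mu (+) mu'), kap2; split; last first.
- by apply: (eqA_trans eqx); rewrite signr_addb -mulrA; exact: eqAMl.
- exact: skap2.
by apply: (perm_trans kk2); rewrite -!cats1 perm_cat2r.
Qed.
End Words.

(** With its own upper indices and parities as [p] and [e], every word becomes an instance of
    [mkword], so results about keys apply to arbitrary words. *)
Lemma mkword_keys (w : seq letter) :
  let p r := (nth (false, 0%:Z) w r).1 in
  let e r := odd `|(nth (false, 0%:Z) w r).2|%N in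
  mkword p e (keys p e w) = w.
Proof.
move=> p e; apply: (@eq_from_nth _ (false, 0%:Z)); rewrite ?size_mkseq // => r rw.
rewrite nth_mkseq ?size_mkseq // nth_mkseq // /mkletter addrK {1}/p {p} /e {e}.
case: (nth _ _ _) => q j; congr (_, _) => /=; lia.
Qed.

Lemma normal_form (w : seq letter) :
  eqA (monomial w) 0 \/
  exists (mu : bool) w', [/\ map fst w' = map fst w, normal w' &
    eqA (monomial w) ((-1) ^+ mu * monomial w')].
Proof.
rewrite -[w]mkword_keys; set p := fun r => _; set e := fun r => _.
case: (straightensP p e (keys p e w)) => [|[mu [kap' [kk' skap' eqk']]]].
  by left.
right; exists mu, (mkword p e kap'); split=> //; last by rewrite normal_mkword.
by rewrite !map_fst_mkword (perm_size kk').
Qed.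

(** * Uniqueness of normal forms *)

(** For lists of equal length with [kap0] free of repetitions, this is the sign of the permutation
    carrying one list to the other, and 0 if there is none. *)
Definition overlap (kap0 kap : seq int) : int :=
  \det (\matrix_(i < size kap0, j < size kap0)
    (nth 0 kap i == nth 0 kap0 j)%:R : 'M[int]_(size kap0)).

Lemma overlap_swap kap0 k1 x y k2 :
  size (k1 ++ [:: x, y & k2]) = size kap0 ->
  overlap kap0 (k1 ++ [:: x, y & k2]) = - overlap kap0 (k1 ++ [:: y, x & k2]).
Proof.
rewrite size_cat /= => sk.
have lt1 : (size k1 < size kap0)%N by rewrite -sk; lia.
have lt2 : ((size k1).+1 < size kap0)%N by rewrite -sk; lia.
pose s := tperm (Ordinal lt1) (Ordinal lt2).
rewrite /overlap; set A := matrix_of_fun _ _; set B := matrix_of_fun _ _.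
have -> : A = row_perm s B.
  apply/matrixP => i j; rewrite !mxE /s; congr (_ == _)%:R.
  case: tpermP => [->|->|/eqP i1 /eqP i2].
  - by rewrite !nth_cat /= ltnn ltnNge leqnSn /= subnn subSn // subnn.
  - by rewrite !nth_cat /= ltnn ltnNge leqnSn /= subnn subSn // subnn.
  rewrite !nth_cat; case: ltnP => // ki.
  move: i1 i2; rewrite -!val_eqE /= => /eqP i1 /eqP i2.
    have aux (m q : nat) : (q <= m)%N -> m <> q -> m <> q.+1 ->
    (m - q = (m - q.+2).+2)%N by lia.
  by rewrite (aux _ _ ki i1 i2).
rewrite row_permE det_mulmx det_perm odd_tperm.
have -> : (Ordinal lt1 != Ordinal lt2) by rewrite -val_eqE /=; lia.
by rewrite expr1 mulN1r.
Qed.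

Lemma overlap_self kap : uniq kap -> overlap kap kap = 1.
Proof.
move=> ku; rewrite -(det1 _ (size kap)); congr (\det _).
by apply/matrixP => i j; rewrite !mxE nth_uniq.
Qed.

(** A key absent from [kap0] would give a zero row. So [kap] lies inside [kap0], and strictly
    increasing lists of the same length are then equal. *)
Lemma overlap_neq0 kap0 kap : sorted <%R kap0 -> sorted <%R kap ->
  size kap = size kap0 -> overlap kap0 kap != 0 -> kap = kap0.
Proof.
move=> sk0 sk sz ov.
have sub : {subset kap <= kap0}.
  move=> x xk; apply/negPn/negP => xk0; case/negP: ov.
  have lti : (index x kap < size kap0)%N by rewrite -sz index_mem.
  rewrite /overlap (expand_det_row _ (Ordinal lti)) big1 // => j _.
  rewrite mxE /= nth_index //; case: eqP => [xj|]; last by rewrite mul0r.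
  by case/negP: xk0; rewrite xj mem_nth.
have uk : uniq kap := sorted_uniq lt_trans ltxx sk.
have [|_ eqk] := uniq_min_size uk sub; first by rewrite sz.
exact: (irr_sorted_eq lt_trans ltxx sk sk0 eqk).
Qed.

(** * A linear functional vanishing on the relations *)

Lemma freeAlg_ind (P : freeAlg -> Prop) :
    (forall x y, P x -> P y -> P (x + y)) -> P 0 ->
  (forall (c : int) m, P << c *g m >>) -> forall x, P x.
Proof. by move=> PD P0 PU x; rewrite [x]monalgE; apply: big_ind. Qed.

Section Functional.
Variables (p e : nat -> bool) (kap0 : seq int).

Definition mktail (r : nat) (kap : seq int) : seq letter :=
  mkseq (fun i => mkletter p e (r + i)%N (nth 0 kap i)) (size kap).

Lemma mkword_cat k1 k2 :
  mkword p e (k1 ++ k2) = mkword p e k1 ++ mktail (size k1) k2.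
Proof.
rewrite /mkword /mktail /mkseq size_cat iotaD map_cat add0n; congr (_ ++ _).
  by apply/eq_in_map => r; rewrite mem_iota add0n nth_cat => /andP[_ ->].
rewrite -[X in iota X _](addn0 (size k1)) iotaDl -map_comp.
apply: eq_map => i /=; congr mkletter.
by rewrite nth_cat ltnNge leq_addr /= addKn.
Qed.

Lemma mkword_cat2 k1 x y k2 :
  mkword p e (k1 ++ [:: x, y & k2]) =
  mkword p e k1 ++ [:: mkletter p e (size k1) x, mkletter p e (size k1).+1 y
    & mktail (size k1).+2 k2].
Proof.
have -> : k1 ++ [:: x, y & k2] = rcons (rcons k1 x) y ++ k2.
  by rewrite -!cats1 -!catA.
by rewrite mkword_cat !mkword_rcons !size_rcons -!cats1 -!catA.
Qed.

Lemma mkword_catP kap w1 a b w2 :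
    mkword p e kap = w1 ++ [:: a, b & w2] ->
  exists k1 x y k2, [/\ kap = k1 ++ [:: x, y & k2], w1 = mkword p e k1,
    a = mkletter p e (size k1) x, b = mkletter p e (size k1).+1 y
    & w2 = mktail (size k1).+2 k2].
Proof.
move=> wk; have := congr1 size wk; rewrite size_mkword size_cat /= => sk.
pose k1 := take (size w1) kap.
have s1 : size k1 = size w1 by rewrite size_takel // sk; lia.
have : size (drop (size w1) kap) = (size w2).+2 by rewrite size_drop sk; lia.
case dk: (drop _ _) => [|x [|y k2]] // _.
have kE : kap = k1 ++ [:: x, y & k2] by rewrite -dk cat_take_drop.
move: wk; rewrite kE mkword_cat2 => /eqP.
rewrite eqseq_cat ?size_mkword // => /andP[/eqP w1E /eqP[aE bE w2E]].
by exists k1, x, y, k2.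
Qed.

(** Extends [overlap] by 0: the equation with [mkword] tests that the word has upper indices [p] and
    parities [e]. *)
Definition word_coef (w : seq letter) : int :=
  if (w == mkword p e (keys p e w)) && (size w == size kap0)
  then overlap kap0 (keys p e w) else 0.

Lemma word_coef_mkword kap : size kap = size kap0 ->
  word_coef (mkword p e kap) = overlap kap0 kap.
Proof. by move=> sk; rewrite /word_coef mkwordK eqxx size_mkword sk eqxx. Qed.

Lemma word_coefP w : word_coef w != 0 ->
  exists2 kap, w = mkword p e kap & size kap = size kap0.
Proof.
rewrite /word_coef; case: ifP => [/andP[/eqP wE /eqP sw] _|]; last by rewrite eqxx.
by exists (keys p e w) => //; rewrite size_mkseq.
Qed.

Definition swapped_upper (a b : letter) : letter :=
  (b.1, a.2 - 2 * Kfun b.1 a.1 + parity (a.2 + b.2)).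
Definition swapped_lower (a b : letter) : letter :=
  (a.1, b.2 + 2 * Kfun b.1 a.1 - parity (a.2 + b.2)).

Lemma word_coef_swap_half w1 a b w2 : word_coef (w1 ++ [:: a, b & w2]) != 0 ->
  word_coef (w1 ++ [:: swapped_lower a b, swapped_upper a b & w2]) =
  - word_coef (w1 ++ [:: a, b & w2]).
Proof.
move=> /word_coefP[kap /esym wk sk].
have [k1 [x [y [k2 [kE -> -> -> ->]]]]] := mkword_catP wk.
rewrite /swapped_lower /swapped_upper /= swap_upper swap_lower.
rewrite -!mkword_cat2 !word_coef_mkword; last first.
- by rewrite -sk kE !size_cat.
- by rewrite -sk kE !size_cat.
by rewrite overlap_swap // -sk kE !size_cat.
Qed.

(** The exchange keeps both upper indices and the sum of the lower ones, hence K and the parity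
    term, so it is an involution. *)
Lemma swappedK a b :
  swapped_lower (swapped_lower a b) (swapped_upper a b) = a /\
  swapped_upper (swapped_lower a b) (swapped_upper a b) = b.
Proof.
case: a b => [pa ja] [pb jb]; rewrite /swapped_lower /swapped_upper /parity /=.
by split; congr (_, _); lia.
Qed.

(** If the first coefficient is nonzero, the word comes from keys and the determinant is
    antisymmetric; if it is zero, the involution rules out a nonzero second one. *)
Lemma word_coef_swap w1 a b w2 :
  word_coef (w1 ++ [:: a, b & w2]) +
  word_coef (w1 ++ [:: swapped_lower a b, swapped_upper a b & w2]) = 0.
Proof.
have [c0|c0] := eqVneq (word_coef (w1 ++ [:: a, b & w2])) 0; last first.
  by rewrite word_coef_swap_half // subrr.
rewrite c0 add0r; apply/eqP/negPn/negP => c1.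
have := word_coef_swap_half c1; have [-> ->] := swappedK a b.
by rewrite c0 => /esym/eqP; rewrite oppr_eq0 (negPf c1).
Qed.

Definition functional (x : freeAlg) : int :=
  mmap idfun (fun m : fmonom letter => word_coef (rev m)) x.

Lemma functional0 : functional 0 = 0.
Proof. exact: mmap0. Qed.

Lemma functionalD : {morph functional : x y / x + y}.
Proof. exact: mmapD. Qed.

Lemma functionalD0 x y :
  functional x = 0 -> functional y = 0 -> functional (x + y) = 0.
Proof. by rewrite functionalD => -> ->; rewrite addr0. Qed.

Lemma functionalN : {morph functional : x / - x}.
Proof. exact: mmapN. Qed.

Lemma functionalMz (n : int) : {morph functional : x / x *~ n}.
Proof.
by move=> x; rewrite /functional (raddfMz (mmap idfun _)).
Qed.

Lemma functionalU (c : int) (m : fmonom letter) :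
  functional << c *g m >> = c * word_coef (rev m).
Proof. exact: mmapU. Qed.

Lemma functional_monomial w : functional (monomial w) = word_coef w.
Proof. by rewrite monomialE functionalU mul1r revK. Qed.

Lemma functional_sandwich x :
  (forall w1 w2, functional (monomial w1 * x * monomial w2) = 0) ->
  forall a b, functional (a * x * b) = 0.
Proof.
move=> x0 a b.
have UE (c : int) (m : fmonom letter) :
    << c *g m >> = monomial (rev m) *~ c :> freeAlg.
  rewrite monomialE revK -[c in LHS]intz.
  by rewrite (raddfMz (@mkmalgU _ int m)); case: m.
elim/freeAlg_ind: a => [a1 a2 IH1 IH2||c m].
- by rewrite !mulrDl; exact: functionalD0.
- by rewrite !mul0r functional0.
elim/freeAlg_ind: b => [b1 b2 IH1 IH2||c' m'].
- by rewrite mulrDr; exact: functionalD0.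
- by rewrite mulr0 functional0.
by rewrite !UE mulrzAr !mulrzAl !functionalMz x0 !mul0rz.
Qed.

Lemma functional_relator p2 p1 j2 j1 : forall a b,
  functional (a * relator p2 p1 j2 j1 * b) = 0.
Proof.
apply: functional_sandwich => w1 w2.
have gens (a b : letter) : monomial w1 * (gen b.1 b.2 * gen a.1 a.2) * monomial w2
    = monomial (w2 ++ [:: a, b & w1]).
  rewrite -[a :: b :: w1]/([:: a; b] ++ w1) !monomial_cat.
  by rewrite /(monomial [:: a; b]) !big_cons big_nil mulr1 !mulrA.
have := word_coef_swap w2 (p1, j1) (p2, j2) w1.
rewrite -!functional_monomial -!gens /relator /=.
set u := gen _ _ * gen _ _; set v := gen _ _ * gen _ _ => uv0.
(* When the two monomials coincide, [uv0] says that twice the value is 0, and the integers have no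
   2-torsion. *)
case: eqP uv0 => [<-|_]; last by rewrite -functionalD -mulrDl -mulrDr.
by lia.
Qed.

Lemma functional_relIdeal x : relIdeal x -> functional x = 0.
Proof.
(* Outer factors on both sides let the induction pass through multiplication on either side. *)
move=> xI; suff ideal0 a b : functional (a * x * b) = 0.
  by rewrite -[x]mul1r -[1 * x]mulr1.
elim: xI a b => {x} [p2 p1 j2 j1||x y _ IHx _ IHy|c x _ IH|x c _ IH] a b.
- exact: functional_relator.
- by rewrite mulr0 mul0r functional0.
- rewrite mulrBr mulrBl; apply: functionalD0; first exact: IHx.
  by rewrite functionalN; apply/eqP; rewrite oppr_eq0; apply/eqP; exact: IHy.
- by rewrite mulrA.
- by rewrite mulrA -mulrA.
Qed.

Lemma functional_eqA x y : eqA x y -> functional x = functional y.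
Proof.
by move=> /functional_relIdeal/eqP; rewrite functionalD functionalN subr_eq0 => /eqP.
Qed.

Lemma functional_sign (mu : bool) x :
  functional ((-1) ^+ mu * x) = (-1) ^+ mu * functional x.
Proof. by rewrite !mulr_sign; case: mu => //; exact: functionalN. Qed.
End Functional.

(** The functional attached to the keys of [w] is 1 on [w], hence nonzero on [w']. This puts [w'] in
    the same component with the same keys, and then the signs agree. *)
Lemma normal_eqA (mu mu' : bool) w w' : normal w -> normal w' ->
  eqA ((-1) ^+ mu * monomial w) ((-1) ^+ mu' * monomial w') ->
  w = w' /\ mu = mu'.
Proof.
rewrite -[w]mkword_keys; set p := fun r => _; set e := fun r => _.
set kap := keys p e w; rewrite normal_mkword => skap nw'.
move=> /(functional_eqA p e kap).
rewrite !functional_sign !functional_monomial word_coef_mkword //.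
rewrite overlap_self ?(sorted_uniq lt_trans ltxx) // mulr1 => eqmu.
have c0 : word_coef p e kap w' != 0.
  apply/eqP => c0; move: eqmu; rewrite c0 mulr0.
  by move/eqP; rewrite signr_eq0.
have [kap' w'E sk] := word_coefP c0.
move: c0 nw' eqmu; rewrite w'E normal_mkword word_coef_mkword // => ov sk' eqmu.
have kk : kap' = kap by apply: overlap_neq0.
split; first by rewrite kk.
move: eqmu; rewrite kk overlap_self ?(sorted_uniq lt_trans ltxx) // mulr1.
by case: mu; case: mu'.
Qed.

Lemma normal_neq0 w : normal w -> ~ eqA (monomial w) 0.
Proof.
rewrite -[w]mkword_keys; set p := fun r => _; set e := fun r => _.
set kap := keys p e w; rewrite normal_mkword => skap.
move=> /(functional_eqA p e kap).
rewrite functional_monomial functional0 word_coef_mkword //.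
by rewrite overlap_self // (sorted_uniq lt_trans ltxx).
Qed.

(** * The action on paths *)

Definition shift (x : letter) : int := x.2 - (nat_of_bool x.1)%:Z.

(** Normality gives this relation between consecutive letters. As it is antisymmetric and
    transitive, a normal word is recoverable from the multiset of its letters. *)
Definition strict_or_eq (x y : letter) : bool := (shift x < shift y) || (x == y).

Lemma strict_or_eq_trans : transitive strict_or_eq.
Proof.
rewrite /strict_or_eq => y x z /orP[xy|/eqP->] /orP[yz|/eqP<-];
  rewrite ?eqxx ?orbT //.
- by rewrite (lt_trans xy yz).
- by rewrite xy.
- by rewrite yz.
Qed.

Lemma strict_or_eq_anti : antisymmetric strict_or_eq.
Proof.
rewrite /strict_or_eq => x y /andP[/orP[xy|/eqP->//] /orP[yx|/eqP->//]].
by move: (lt_trans xy yx); rewrite ltxx.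
Qed.

Lemma normal_strict_or_eq w : normal w -> sorted strict_or_eq w.
Proof.
apply: sub_sorted => -[p i] [q j]; rewrite /strict_or_eq /shift /Hfun /=.
by rewrite xpair_eqE; case: p; case: q => /=; lia.
Qed.

(** Shifts increase weakly, so the counted prefix consists of the letters of shift below i; the
    resulting sum no longer depends on their order. *)
Lemma height_take_count w (i : int) : sorted <=%R (shifts w) ->
  height (take (count (fun l => l < i) (shifts w)) (map fst w)) =
  \sum_(x <- w | shift x < i) (-1) ^+ x.1.
Proof.
elim: w => [|x w IH] /=; first by rewrite /height !big_nil.
rewrite (path_sortedE le_trans) => /andP[allx /IH IHw].
rewrite big_cons -/(shift x); case: ltP => xi /=.
  by rewrite add0n /height big_cons -/(height _) IHw.
rewrite add0n -IHw.
suff -> : count (fun l => l < i) (shifts w) = 0%N by rewrite !take0.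
apply/eqP; rewrite -leqn0 leqNgt -has_count; apply/hasPn => l lw.
by rewrite -leNgt (le_trans xi) // (allP allx).
Qed.

(** Only the letters [(false, i)] and [(true, i + 1)] have shift i, with signs 1 and -1. *)
Lemma shift_sum_step w (i : int) :
  \sum_(x <- w | shift x < i + 1) (-1) ^+ x.1 -
  \sum_(x <- w | shift x < i) (-1) ^+ x.1 =
  (count_mem (false, i) w)%:Z - (count_mem (true, i + 1) w)%:Z.
Proof.
elim: w => [|[q j] w IH] /=; first by rewrite !big_nil.
rewrite !big_cons /shift /= !xpair_eqE in IH *.
case: q => /=.
  have [eqj|nj] := eqVneq j (i + 1).
    have -> : j - 1 < i + 1 by lia.
    have -> : j - 1 < i = false by lia.
    lia.
  have -> : (j - 1 < i + 1) = (j - 1 < i) by lia.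
  case: ifP => _; lia.
have [eqj|nj] := eqVneq j i.
  have -> : j - 0 < i + 1 by lia.
  have -> : j - 0 < i = false by lia.
  lia.
have -> : (j - 0 < i + 1) = (j - 0 < i) by lia.
case: ifP => _; lia.
Qed.

Lemma bracket_inj k w w' : normal w -> normal w' ->
  bracket k w = bracket k w' -> w = w'.
Proof.
(* The step of the sequence at i adds up the signs of the letters of shift i;
   normality forces these letters to coincide, so it determines their number. *)
move=> nw nw' bE.
have fE (i : int) : \sum_(x <- w | shift x < i) (-1) ^+ x.1
          = \sum_(x <- w' | shift x < i) (-1) ^+ x.1 :> int.
  rewrite -!height_take_count; try exact: shifts_sorted.
  move: (congr1 (fun f => f i) bE); rewrite /bracket /= /parity.
  set h := height _; set h' := height _.
  (* The sequence takes the value h at even i and k - h at odd i, so either way it determines h. *)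
  have : (i %% 2)%Z = 0 \/ (i %% 2)%Z = 1 by lia.
  by case=> ->; lia.
have excl u (i : int) : normal u ->
    count_mem (false, i) u = 0%N \/ count_mem (true, i + 1) u = 0%N.
  move=> /normal_strict_or_eq su.
  have [f0|f0] := eqVneq (count_mem (false, i) u) 0%N; first by left.
  have [t0|t0] := eqVneq (count_mem (true, i + 1) u) 0%N; first by right.
  have {}f0 : (false, i) \in u by rewrite -has_pred1 has_count lt0n.
  have {}t0 : (true, i + 1) \in u by rewrite -has_pred1 has_count lt0n.
  have := sorted_ltn_index strict_or_eq_trans su.
  case: (ltngtP (index (false, i) u) (index (true, i + 1) u)).
  - by move=> lt /(_ _ _ f0 t0 lt); rewrite /strict_or_eq /shift /= xpair_eqE; lia.
  - by move=> lt /(_ _ _ t0 f0 lt); rewrite /strict_or_eq /shift /= xpair_eqE; lia.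
  move=> eqi; have := nth_index (false, i) f0; rewrite eqi nth_index //.
apply: (sorted_eq strict_or_eq_trans strict_or_eq_anti);
  rewrite ?normal_strict_or_eq //.
apply/allP => -[q j] _ /=; apply/eqP.
pose i := j - (nat_of_bool q)%:Z.
have := shift_sum_step w i; rewrite !fE shift_sum_step.
have := excl w i nw; have := excl w' i nw'.
have arith (m m' n n' : nat) : m' = 0%N \/ n' = 0%N -> m = 0%N \/ n = 0%N ->
    m'%:Z - n'%:Z = m%:Z - n%:Z -> m = m' /\ n = n' by lia.
move=> ex ex' /(arith _ _ _ _ ex ex'); rewrite /i {i ex ex'}.
by case: q => /=; rewrite ?subrK ?subr0 => -[].
Qed.

Lemma restricted_rcons k s q : restricted k (rcons s q) -> restricted k s.
Proof.
rewrite /restricted size_rcons => /allP h; apply/allP => r.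
rewrite mem_iota => /andP[r1 rs].
have := h r; rewrite mem_iota -cats1 takel_cat; last by rewrite -ltnS -add1n.
by apply; rewrite r1 /=; move: rs; rewrite !add1n ltnS => /leqW.
Qed.

(** * Iterated action on the vacuum *)

Section Action.
Variable k : nat.
Implicit Types (w : seq letter) (b : pathSeq k).

Lemma ketE w : admissible k w ->
  exists2 b, val b = bracket k w & ket k w = << b >>.
Proof.
move=> aw; have bw : `[< exists2 w', admissible k w' & bracket k w = bracket k w' >].
  by apply/asboolP; exists w.
exists (PathSeq bw) => //; rewrite /ket.
by case: insubP => [b _ bE|/negP//]; congr << _ >>; apply: val_inj.
Qed.

Lemma phi0 p j : phi p j (0 : Fock k) = 0.
Proof. by rewrite /phi msupp0 big_seq_fset0. Qed.

Lemma phiU p j (c : int) b : phi p j (<< c *g b >> : Fock k) = c *: actBasis p j b.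
Proof.
rewrite /phi msuppU; case: eqP => [->|_]; first by rewrite big_seq_fset0 scale0r.
by rewrite big_seq_fset1 mcoeffUU.
Qed.

Lemma bracket_val_inj b w w' : admissible k w -> val b = bracket k w ->
  admissible k w' -> val b = bracket k w' -> w' = w.
Proof.
move=> /andP[_ nw] bw /andP[_ nw'] bw'.
by apply: (@bracket_inj k) => //; rewrite -bw -bw'.
Qed.

Lemma actBasis_null p j b w : admissible k w -> val b = bracket k w ->
    restricted k (map fst (rcons w (p, j))) ->
  eqA (monomial (rcons w (p, j))) 0 -> actBasis p j b = 0.
Proof.
move=> aw bw rw z; apply: xget_unique; first exact: (ActNull aw bw).
move=> v spec; case: spec aw bw rw z => // {}b w1 mu w' aw1 bw1 _ nz _ _ _ aw bw _ z.
by case: nz; rewrite (bracket_val_inj aw bw aw1 bw1).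
Qed.

(** No other outcome satisfies [actSpec]: [bracket_inj] fixes the word behind [b], [normal_neq0]
    excludes a null product, and [normal_eqA] fixes the sign and the normal word. *)
Lemma actBasis_normal p j b w (mu : bool) w' :
    admissible k w -> val b = bracket k w ->
    restricted k (map fst (rcons w (p, j))) ->
    map fst w' = map fst (rcons w (p, j)) -> normal w' ->
    eqA (monomial (rcons w (p, j))) ((-1) ^+ mu * monomial w') ->
  actBasis p j b = (-1) ^+ mu *: ket k w'.
Proof.
move=> aw bw rw fw' nw' eqw'.
have nz : ~ eqA (monomial (rcons w (p, j))) 0.
  move=> z; apply: (normal_neq0 nw').
  have /(eqAMl0 ((-1) ^+ mu)) := eqA_trans (eqA_sym eqw') z.
  by rewrite mulrA -signr_addb addbb mul1r.
apply: xget_unique; first exact: (ActNormal aw bw).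
move=> v spec.
case: spec aw bw rw fw' eqw' nz => {}b w1.
- move=> aw1 bw1 nr aw bw; rewrite -(bracket_val_inj aw bw aw1 bw1).
  by rewrite (negPf nr).
- move=> aw1 bw1 z aw bw; rewrite -(bracket_val_inj aw bw aw1 bw1).
  by move=> _ _ _ /(_ z).
move=> mu1 w1' aw1 bw1 _ _ _ nw1' eqw1' aw bw.
rewrite -(bracket_val_inj aw bw aw1 bw1) => _ _ eqw' _.
by have [-> ->] := normal_eqA nw1' nw' (eqA_trans (eqA_sym eqw1') eqw').
Qed.

Definition run (u : seq letter) : Fock k :=
  foldl (fun v x => phi x.1 x.2 v) (vacuum k) u.

(** Straightening after each operator or once at the end agrees, because left multiplication
    respects [eqA]. Prefixes of a restricted path are restricted, so a zero can only come from the
    algebra. *)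
Lemma runP u : restricted k (map fst u) ->
  (eqA (monomial u) 0 /\ run u = 0) \/
  exists (mu : bool) w, [/\ normal w, eqA (monomial u) ((-1) ^+ mu * monomial w),
    map fst w = map fst u & run u = (-1) ^+ mu *: ket k w].
Proof.
elim/last_ind: u => [|u [p j] IH] ru.
  by right; exists false, [::]; split=> //; rewrite ?mul1r ?scale1r //; exact: eqA_refl.
rewrite /run foldl_rcons -/(run u) /=.
have ru' : restricted k (map fst u) by move: ru; rewrite map_rcons => /restricted_rcons.
case: (IH ru') => [[z ->]|[mu [w [nw eqw fw ->]]]].
  by left; rewrite phi0 monomial_rcons; split=> //; exact: eqAMl0.
have aw : admissible k w by rewrite /admissible fw ru'.
have rw : restricted k (map fst (rcons w (p, j))) by rewrite map_rcons fw -map_rcons.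
have equ : eqA (monomial (rcons u (p, j)))
    ((-1) ^+ mu * monomial (rcons w (p, j))).
  rewrite !monomial_rcons; have := eqAMl (gen p j) eqw.
  by rewrite !mulr_sign; case: mu {eqw}; rewrite ?mulrN.
have [b bw ->] := ketE aw.
(* The sign is moved into the coefficient of the single basis term, where [phiU] applies. *)
have -> : phi p j ((-1) ^+ mu *: << b >> : Fock k) = (-1) ^+ mu *: actBasis p j b.
  rewrite -phiU; congr (phi _ _ _); apply/malgP => i.
  by rewrite mcoeffZ !mcoeffU mulrnAr mulr1.
case: (normal_form (rcons w (p, j))) => [z|[mu' [w' [fw' nw' eqw']]]].
  left; rewrite (actBasis_null aw bw rw z) scaler0; split=> //.
  by apply: (eqA_trans equ); exact: eqAMl0.
right; exists (mu (+) mu'), w'; split.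
- exact: nw'.
- by apply: (eqA_trans equ); rewrite signr_addb -mulrA; exact: eqAMl.
- by rewrite fw' !map_rcons fw.
by rewrite (actBasis_normal aw bw rw fw' nw' eqw') scalerA signr_addb.
Qed.
End Action.

(** * Coefficients *)

Section Coefficient.
Variables (n : nat) (p e : n.-tuple bool).
Implicit Types (m a : expo n).

Let tshift := total_shift (nth false p) (nth false e).

Definition keysOf m : seq int := [seq m i + tshift i | i <- enum 'I_n].

Lemma size_keysOf m : size (keysOf m) = n.
Proof. by rewrite size_map size_enum_ord. Qed.

Lemma nth_keysOf m (i : 'I_n) : nth 0 (keysOf m) i = m i + tshift i.
Proof. by rewrite (nth_map i) ?size_enum_ord // nth_ord_enum. Qed.

Lemma keysOf_inj : injective keysOf.
Proof.
move=> m m' mm'; apply/ffunP => i.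
by have := nth_keysOf m i; rewrite mm' nth_keysOf => /addIr.
Qed.

Lemma nth_wordOf m (i : 'I_n) x0 :
  nth x0 (wordOf p e m) i = (tnth p i, 2 * m i + (tnth e i)%:Z).
Proof. by rewrite (nth_map i) ?size_enum_ord // nth_ord_enum. Qed.

Lemma size_wordOf m : size (wordOf p e m) = n.
Proof. by rewrite size_map size_enum_ord. Qed.

Lemma wordOfE m : wordOf p e m = mkword (nth false p) (nth false e) (keysOf m).
Proof.
apply: (@eq_from_nth _ (false, 0%:Z)).
  by rewrite size_wordOf size_mkword size_keysOf.
rewrite size_wordOf => r rn.
rewrite (nth_wordOf m (Ordinal rn)) nth_mkseq ?size_keysOf //.
by rewrite (nth_keysOf m (Ordinal rn)) /mkletter /= addrK !(tnth_nth false).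
Qed.

Lemma map_fst_wordOf m : map fst (wordOf p e m) = p.
Proof.
by rewrite -map_comp -[RHS]map_tnth_enum.
Qed.

(** Up to a constant, [nu] is the negative of [tshift], so the numbers m_j - nu_j have the same
    differences as the keys. *)
Lemma nuE (j : 'I_n) : nu p e j = tshift n.-1 - tshift j.
Proof.
have jn : (j <= n.-1)%N by case: n j => [[]|n' j] //=; rewrite -ltnS.
rewrite /tshift /total_shift (big_cat_nat (leq0n j) jn) /= [X in X - _]addrC addrK.
rewrite /nu -sumrN; apply: eq_bigr => r _.
by rewrite /swap_shift opprD opprK.
Qed.

(** Each step of [Isum] is H of neighbouring upper indices, so M asks exactly for normality of
    [wordOf p e m]. *)
Lemma MsetP m : Mset p e m <-> sorted <%R (keysOf m).
Proof.
have step (r s : 'I_n) : s = r.+1 :> nat ->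
    (2 * m r + (tnth e r)%:Z - 2 * Isum p r <= 2 * m s + (tnth e s)%:Z - 2 * Isum p s)
    = (m r + tshift r < m s + tshift s).
  move=> sr; rewrite /Isum sr /tshift total_shiftS big_nat_recr //=.
  rewrite !(tnth_nth false) /swap_shift sr /Kfun /Hfun.
  set I := \sum_(_ <= _ < _) _.
  by move: (nth _ p r) (nth _ p r.+1) (nth _ e r) (nth _ e r.+1) => [] [] [] [] /=; lia.
split=> [mM|/(sortedP 0) sm r s sr]; last first.
  have := sm r; rewrite size_keysOf -sr => /(_ (ltn_ord s)).
  by rewrite !nth_keysOf step.
apply/(sortedP 0) => r; rewrite size_keysOf => rn.
have := mM (Ordinal (ltnW rn)) (Ordinal rn) erefl; rewrite step //.
by rewrite -!nth_keysOf.
Qed.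

Lemma zpow_prod (d : 'I_n -> int) :
  \prod_i zpow i (d i) = << [ffun i => d i] : expo n >> :> laurent n.
Proof.
have UM (u v : expo n) : << u + v >> = (<< u >> : laurent n) * << v >>.
  by rewrite [RHS]grmulUU mulr1.
have U0 : << (0 : expo n) >> = 1 :> laurent n by [].
rewrite /zpow -(big_morph (fun u : expo n => << u >> : laurent n) UM U0).
congr (<< _ *g _ >>); apply/ffunP => i; rewrite sum_ffunE ffunE (bigD1 i) //=.
rewrite ffunE eqxx big1 ?addr0 // => j /negPf ji.
by rewrite ffunE eq_sym ji.
Qed.

(** In the Leibniz expansion the term of s is a signed monomial with exponents nu_i + m_{s i} -
    nu_{s i}. By [nuE] this equals a_i exactly when key i of [a] is key s i of [m], which a product
    of 0/1 entries detects. *)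
Lemma Ccoef_overlap m a : (Ccoef p e m)@_a = overlap (keysOf m) (keysOf a).
Proof.
have -> : overlap (keysOf m) (keysOf a) =
    \det (\matrix_(i < n, j < n) (a i + tshift i == m j + tshift j)%:R : 'M[int]_n).
  transitivity (\det (\matrix_(i < n, j < n)
      (nth 0 (keysOf a) i == nth 0 (keysOf m) j)%:R : 'M[int]_n)).
    (* The elimination replaces the matrix dimension [size (keysOf m)] by n. *)
    by rewrite /overlap; case: (size _) / (esym (size_keysOf m)).
  by congr (\det _); apply/matrixP => i j; rewrite !mxE !nth_keysOf.
rewrite /Ccoef /determinant mulr_sumr.
rewrite (big_morph (mcoeff a) (mcoeffD a) (mcoeff0 _)).
apply: eq_bigr => s _.
under eq_bigr do rewrite mxE.
under [in RHS]eq_bigr do rewrite mxE.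
rewrite !zpow_prod mulrCA.
set u := [ffun i => nu p e i]; set v := [ffun i => _].
have -> : (<< u >> : laurent n) * << v >> = << u + v >>.
  by rewrite [LHS]grmulUU mulr1.
rewrite !mulr_sign.
have -> : \prod_i (a i + tshift i == m (s i) + tshift (s i))%:R
   = (u + v == a)%:R :> int.
  case: eqP => [<-|uva].
    rewrite big1 // => i _; rewrite !ffunE !nuE.
    by case: eqP => // -[]; ring.
  have /existsP[i ia] : [exists i, a i + tshift i != m (s i) + tshift (s i)].
    apply: contraT => /existsPn ai; case: uva; apply/ffunP => i.
    have /eqP := negbNE (ai i); rewrite !ffunE !nuE => aiE.
    by rewrite -[RHS](addrK (tshift i)) aiE; ring.
  by rewrite (bigD1 i) //= (negPf ia) mul0r.
by case: (odd_perm s); rewrite ?mcoeffN mcoeffU.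
Qed.

Lemma wordOf_surj a w kap kap' p' e' :
    wordOf p e a = mkword p' e' kap -> w = mkword p' e' kap' ->
  size kap = size kap' -> exists m, w = wordOf p e m.
Proof.
move=> aE wE sk.
have sw : size w = n by rewrite wE size_mkword -sk -(size_mkword p' e') -aE size_wordOf.
exists [ffun i : 'I_n => ((nth (false, 0%:Z) w i).2 %/ 2)%Z].
apply: (@eq_from_nth _ (false, 0%:Z)); rewrite ?size_wordOf ?sw // => r rn.
rewrite (nth_wordOf _ (Ordinal rn)) ffunE /=.
have := nth_wordOf a (Ordinal rn) (false, 0%:Z).
have rk : (r < size kap)%N by rewrite -(size_mkword p' e') -aE size_wordOf.
rewrite aE wE !nth_mkseq -?sk // /mkletter /= => -[-> eE]; congr (_, _).
by move: eE; case: (e' r); case: (tnth e _) => /=; lia.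
Qed.
End Coefficient.

Theorem proposition3 (k n : nat) (hk : (1 <= k)%N) (hn : (1 <= n)%N)
    (p e : n.-tuple bool) (hp : restricted k p) :
  is_fsum (Mset p e)
    (fun m => (fun a => (Ccoef p e m)@_a *: ket k (wordOf p e m)))
    (phiProduct k n p e).
Proof.
move=> a.
have -> : phiProduct k n p e a = run k (wordOf p e a).
  rewrite /run /phiProduct /wordOf.
  by elim: (enum 'I_n) (vacuum k) => //= i s IH v; rewrite IH.
(* In this form the coefficient depends only on the class of the monomial of [a], so it can be
   evaluated on the normal form. *)
have Cfun m : (Ccoef p e m)@_a =
    functional (nth false p) (nth false e) (keysOf p e m) (monomial (wordOf p e a)).
  by rewrite Ccoef_overlap functional_monomial wordOfE word_coef_mkword // !size_keysOf.
have [|[z ->]|[mu [w [nw eqw fw ->]]]] := @runP k (wordOf p e a).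
- by rewrite map_fst_wordOf.
- have C0 m : (Ccoef p e m)@_a = 0 by rewrite Cfun (functional_eqA _ _ _ z) functional0.
  split; last by rewrite fsbig1 // => m _; rewrite C0 scale0r.
  rewrite (_ : (_ `&` _)%classic = set0) //.
  by apply/seteqP; split=> m //= [_]; rewrite C0 scale0r eqxx.
(* The functional attached to [w] takes a sign as value on the monomial of [a], hence is nonzero
   there: [wordOf p e a] has the parities of [w]. *)
have [m0 wE] : exists m, w = wordOf p e m.
  move: nw; rewrite -[w]mkword_keys; set p' := fun r => _; set e' := fun r => _.
  set kap := keys p' e' w; rewrite normal_mkword => skap.
  have := functional_eqA p' e' kap eqw.
  rewrite functional_sign !functional_monomial -[w in RHS]mkword_keys.
  rewrite -/p' -/e' -/kap word_coef_mkword // overlap_self; last first.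
    exact: (sorted_uniq lt_trans ltxx skap).
  rewrite mulr1 => ca.
  have /word_coefP[kap' aE sk] : word_coef p' e' kap (wordOf p e a) != 0.
    by rewrite ca signr_eq0.
  exact: (wordOf_surj aE erefl sk).
have sm0 : sorted <%R (keysOf p e m0).
  by move: nw; rewrite wE wordOfE normal_mkword.
(* On strictly increasing keys the overlap is a Kronecker delta, so only m0 contributes to the sum
   over M. *)
have Cm0 m : Mset p e m -> (Ccoef p e m)@_a = (-1) ^+ mu * (m == m0)%:R.
  move=> /MsetP sm; rewrite Cfun (functional_eqA _ _ _ eqw) functional_sign.
  rewrite functional_monomial wE wordOfE word_coef_mkword ?size_keysOf //.
  congr (_ * _); case: eqP => [->|mm0].
    by rewrite overlap_self // (sorted_uniq lt_trans ltxx).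
  apply/eqP/negPn/negP => ov; apply: mm0; apply: (@keysOf_inj _ p e).
  by apply/esym/overlap_neq0; rewrite ?size_keysOf.
have supp m : Mset p e m -> m != m0 -> (Ccoef p e m)@_a *: ket k (wordOf p e m) = 0.
  by move=> mM /negPf mm0; rewrite Cm0 // mm0 mulr0 scale0r.
have m0M : Mset p e m0 by apply/MsetP.
split.
  apply: (@sub_finite_set _ _ [set m0]%classic) => // m /= [mM].
  by case: (eqVneq m m0) => // mm0; rewrite supp // eqxx.
rewrite -(@fsbig_widen _ _ _ _ [set m0]%classic).
- by rewrite fsbig_set1 Cm0 // eqxx mulr1 wE.
- by move=> m ->.
by move=> m /= [mM] /eqP; exact: supp.
Qed.
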